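(* Let $\theta^0_1,\theta^0_2,\theta^1,\theta^\infty_1,\theta^\infty_2,\theta^\infty_3\in\mathbb{C}$ with $\theta^0_1+\theta^0_2+\theta^1+\theta^\infty_1+\theta^\infty_2+\theta^\infty_3=0$, with $0,\theta^0_1,\theta^0_2$ pairwise distinct and $\theta^\infty_1,\theta^\infty_2,\theta^\infty_3$ pairwise distinct. Let $q_1,p_1,q_2,p_2,u,v$ be holomorphic functions of $t$ on a domain of $\mathbb{C}\setminus\{0\}$, with $u,v\ne0$. Define $a,b,c$ by $$ta=p_2(q_2-1)(p_1+p_2+t)-(\theta^0_2+\theta^\infty_2)(p_1+t)-(2\theta^0_2+\theta^1+2\theta^\infty_2+\theta^\infty_3)p_2,$$ $$tb=p_1(q_1-1)(p_1+p_2+t)-\theta^\infty_3(p_2+t)-(\theta^0_2+\theta^1+\theta^\infty_2+2\theta^\infty_3)p_1,\qquad c=p_1(q_2-q_1)+\theta^\infty_3,$$ and put $$\hat A_0^{(0)}=\begin{pmatrix}\theta^0_1&t(q_2-1)&t(q_1-1)\\ 0&\theta^0_2&p_2(q_1-q_2)+\theta^0_2+\theta^\infty_2\\ 0&0&0\end{pmatrix},\quad \hat A_1^{(-1)}=\begin{pmatrix}1\\ p_2/t\\ p_1/t\end{pmatrix}(p_1+p_2+t,\,-t,\,-t),$$ $$\hat A_1^{(0)}=\begin{pmatrix}\theta^0_2+\theta^1+\theta^\infty_2+\theta^\infty_3&t(1-q_2)&t(1-q_1)\\ -a&-\theta^0_2-\theta^\infty_2&p_2(q_2-q_1)-\theta^0_2-\theta^\infty_2\\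 -b&p_1(q_1-q_2)-\theta^\infty_3&-\theta^\infty_3\end{pmatrix},$$ $$R=\begin{pmatrix}1&0&0\\ \frac{a}{\theta^\infty_1-\theta^\infty_2}&1&0\\ \frac1{\theta^\infty_1-\theta^\infty_3}\left(b+\frac{ac}{\theta^\infty_1-\theta^\infty_2}\right)&\frac{c}{\theta^\infty_2-\theta^\infty_3}&1\end{pmatrix},\qquad G=R\,\mathrm{diag}(1,u,v).$$ Consider the linear systems $$\frac{\partial Y}{\partial x}=AY,\quad A=G^{-1}\left(\frac{\hat A_1^{(-1)}}{(x-1)^2}+\frac{\hat A_1^{(0)}}{x-1}+\frac{\hat A_0^{(0)}}{x}\right)G,\qquad \frac{\partial Y}{\partial t}=BY,\quad B=-\frac1{t(x-1)}G^{-1}\hat A_1^{(-1)}G .$$ Then the compatibility condition $\partial_tA-\partial_xB+[A,B]=O$ (for all $x$) is equivalent to the Hamiltonian system $\frac{dq_i}{dt}=\frac{\partial H}{\partial p_i}$, $\frac{dp_i}{dt}=-\frac{\partial H}{\partial q_i}$ $(i=1,2)$ with $$tH=tH_{\mathrm V}\left({\theta^\infty_1-1,\ \kappa-1\atop-\theta^\infty_1+\theta^\infty_3+1};t;q_1,p_1\right)+tH_{\mathrm V}\left({\theta^0_2+\theta^\infty_1-\theta^\infty_3-1,\ \kappa-1\atop-\theta^\infty_1+\theta^\infty_2+\theta^\infty_3+1};t;q_2,p_2\right)+2p_1p_2q_1(q_2-1),$$ where $\kappa=\theta^0_1-\theta^0_2+\theta^\infty_1-\theta^\infty_2-\theta^\infty_3$,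 together with $$\frac tu\frac{du}{dt}=p_1(1-2q_1)+(2p_2+t)(1-q_2)-\kappa,\qquad \frac tv\frac{dv}{dt}=(2p_1+t)(1-q_1)+2p_2(1-q_2)-\kappa .$$
   Context: $tH_{\mathrm V}\left({\alpha,\beta\atop\gamma};t;q,p\right)=p(p+t)q(q-1)+\beta pq+\gamma p-(\alpha+\gamma)tq$ defines the Hamiltonian $H_{\mathrm V}$ of the fifth Painlevé equation. The Hamiltonian $H$ is that of the Noumi–Yamada system of type $A_5^{(1)}$; the linear system has regular singularities at $x=0,\infty$ and an irregular singularity at $x=1$, of spectral type $(2)(1),111,111$. *)

(* Defs.v *)
From HB Require Import structures.
From mathcomp Require Import all_boot all_order all_algebra.
From mathcomp Require Import boolp classical_sets reals topology normedtype derive.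
From mathcomp Require Import complex.

Set Implicit Arguments.
Unset Strict Implicit.
Unset Printing Implicit Defensive.

Import Order.TTheory GRing.Theory Num.Theory.
Import numFieldNormedType.Exports.

Local Open Scope ring_scope.
Local Open Scope classical_set_scope.

(* The ascription to [numFieldType] is what gives R[i] the topology and the
   complex derivative provided by the library for every numFieldType. *)
Definition Cplx (R : realType) : numFieldType := complex R.

(* The exponents th0_j, th1, thoo_j are theta^0_j, theta^1, theta^infty_j. *)
Record exponents (K : numFieldType) := Exponents {
  th0_1 : K; th0_2 : K; th1 : K; thoo_1 : K; thoo_2 : K; thoo_3 : K }.

Definition fuchs (K : numFieldType) (th : exponents K) : Prop :=
  th0_1 th + th0_2 th + th1 th + thoo_1 th + thoo_2 th + thoo_3 th = 0.

Definition domain (K : numFieldType) (D : set K) : Prop :=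
  [/\ open D, connected D & D !=set0].

Definition holomorphic_on (K : numFieldType) (D : set K) (f : K -> K) : Prop :=
  forall t, D t -> derivable f t 1.

Definition mx3 (K : numFieldType) (s : seq (seq K)) : 'M[K]_3 :=
  \matrix_(i, j) (nth [::] s i)`_j.

Section LaxMatrices.
Variables (K : numFieldType) (th : exponents K) (t q1 p1 q2 p2 u v : K).

Local Notation th01 := (th0_1 th).
Local Notation th02 := (th0_2 th).
Local Notation th11 := (th1 th).
Local Notation thi1 := (thoo_1 th).
Local Notation thi2 := (thoo_2 th).
Local Notation thi3 := (thoo_3 th).

Definition coef_a : K :=
  (p2 * (q2 - 1) * (p1 + p2 + t) - (th02 + thi2) * (p1 + t)
   - (2 * th02 + th11 + 2 * thi2 + thi3) * p2) / t.

Definition coef_b : K :=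
  (p1 * (q1 - 1) * (p1 + p2 + t) - thi3 * (p2 + t)
   - (th02 + th11 + thi2 + 2 * thi3) * p1) / t.

Definition coef_c : K := p1 * (q2 - q1) + thi3.

Definition hatA0_0 : 'M[K]_3 := mx3
  [:: [:: th01; t * (q2 - 1); t * (q1 - 1)];
      [:: 0; th02; p2 * (q1 - q2) + th02 + thi2];
      [:: 0; 0; 0]].

Definition hatA1_m1 : 'M[K]_3 :=
  (\col_i [:: 1; p2 / t; p1 / t]`_i) *m (\row_j [:: p1 + p2 + t; - t; - t]`_j).

Definition hatA1_0 : 'M[K]_3 := mx3
  [:: [:: th02 + th11 + thi2 + thi3; t * (1 - q2); t * (1 - q1)];
      [:: - coef_a; - th02 - thi2; p2 * (q2 - q1) - th02 - thi2];
      [:: - coef_b; p1 * (q1 - q2) - thi3; - thi3]].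

Definition gaugeR : 'M[K]_3 := mx3
  [:: [:: 1; 0; 0];
      [:: coef_a / (thi1 - thi2); 1; 0];
      [:: (coef_b + coef_a * coef_c / (thi1 - thi2)) / (thi1 - thi3);
          coef_c / (thi2 - thi3); 1]].

Definition gaugeG : 'M[K]_3 := gaugeR *m diag_mx (\row_j [:: 1; u; v]`_j).

End LaxMatrices.

Section LaxPair.
Variables (K : numFieldType) (th : exponents K) (q1 p1 q2 p2 u v : K -> K).

Definition laxA (t x : K) : 'M[K]_3 :=
  let G := gaugeG th t (q1 t) (p1 t) (q2 t) (p2 t) (u t) (v t) in
  invmx G *m
  (((x - 1) ^+ 2)^-1 *: hatA1_m1 t (p1 t) (p2 t)
   + (x - 1)^-1 *: hatA1_0 th t (q1 t) (p1 t) (q2 t) (p2 t)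
   + x^-1 *: hatA0_0 th t (q1 t) (q2 t) (p2 t)) *m G.

Definition laxB (t x : K) : 'M[K]_3 :=
  let G := gaugeG th t (q1 t) (p1 t) (q2 t) (p2 t) (u t) (v t) in
  - (t * (x - 1))^-1 *: (invmx G *m hatA1_m1 t (p1 t) (p2 t) *m G).

Definition zero_curvature (t x : K) : Prop :=
  (fun s => laxA s x)^`()%classic t - (fun y => laxB t y)^`()%classic x
  + (laxA t x *m laxB t x - laxB t x *m laxA t x) = 0.

End LaxPair.

Definition tH_V (K : numFieldType) (alpha beta gamma t q p : K) : K :=
  p * (p + t) * q * (q - 1) + beta * p * q + gamma * p
  - (alpha + gamma) * t * q.

Definition kappa (K : numFieldType) (th : exponents K) : K :=
  th0_1 th - th0_2 th + thoo_1 th - thoo_2 th - thoo_3 th.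

Definition NY_tH (K : numFieldType) (th : exponents K)
    (t q1 p1 q2 p2 : K) : K :=
  tH_V (thoo_1 th - 1) (kappa th - 1) (- thoo_1 th + thoo_3 th + 1) t q1 p1
  + tH_V (th0_2 th + thoo_1 th - thoo_3 th - 1) (kappa th - 1)
      (- thoo_1 th + thoo_2 th + thoo_3 th + 1) t q2 p2
  + 2 * p1 * p2 * q1 * (q2 - 1).

Definition NY_H (K : numFieldType) (th : exponents K)
    (t q1 p1 q2 p2 : K) : K := NY_tH th t q1 p1 q2 p2 / t.

Definition hamiltonian_system (K : numFieldType) (H : K -> K -> K -> K -> K -> K)
    (q1 p1 q2 p2 : K -> K) (t : K) : Prop :=
  [/\ q1^`()%classic t = (fun p => H t (q1 t) p (q2 t) (p2 t))^`()%classic (p1 t),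
      p1^`()%classic t = - (fun q => H t q (p1 t) (q2 t) (p2 t))^`()%classic (q1 t),
      q2^`()%classic t = (fun p => H t (q1 t) (p1 t) (q2 t) p)^`()%classic (p2 t) &
      p2^`()%classic t = - (fun q => H t (q1 t) (p1 t) q (p2 t))^`()%classic (q2 t)].

Definition gauge_equations (K : numFieldType) (th : exponents K)
    (q1 p1 q2 p2 u v : K -> K) (t : K) : Prop :=
  t / u t * u^`()%classic t =
    p1 t * (1 - 2 * q1 t) + (2 * p2 t + t) * (1 - q2 t) - kappa th /\
  t / v t * v^`()%classic t =
    (2 * p1 t + t) * (1 - q1 t) + 2 * p2 t * (1 - q2 t) - kappa th.

(* Main.v *)
Require Import Defs.
From mathcomp Require Import all_boot all_order all_algebra.
From mathcomp Require Import boolp classical_sets reals topology normedtype derive.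
From mathcomp Require Import complex.
From mathcomp Require Import perm ring.

Import Order.TTheory GRing.Theory Num.Theory.
Import numFieldNormedType.Exports.

Local Open Scope ring_scope.
Local Open Scope classical_set_scope.

Set Implicit Arguments.
Unset Strict Implicit.
Unset Printing Implicit Defensive.

(** Conjugation by the gauge G is a time-dependent change of basis: writing W for
the logarithmic derivative G' G^-1, the curvature of the pair (A, B) is
G^-1 X G with
  X = hatA' + [hatA, W] - d/dx hatB + [hatA, hatB],  hatB = - N / (t (x - 1)),
where N is the coefficient of (x - 1)^-2 in hatA.  The matrix X is a combination
of (x - 1)^-2, (x - 1)^-1 and x^-1 with coefficients [pole2], [pole1], [pole0]
free of x, so zero curvature at t for all x amounts to three matrix equations
([zero_curvature_poles], [partial_fractions_eq0]).

W is lower triangular with diagonal (0, u'/u, v'/v).  Because the residue at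
x = 0 is upper triangular with the distinct eigenvalues theta^0_1, theta^0_2, 0,
its equation hatA0' + [hatA0, W + N / t] = 0 forces W + N / t to be upper
triangular: this gives the strictly lower entries of W ([residue_log_lower])
without differentiating a, b, c.  With W known up to its diagonal, the entries
of [pole2] and [pole0] determine in turn u'/u, v'/v, p_1', p_2', q_1', q_2', each
linearly with an invertible coefficient, and the values found are the
Hamiltonian flow and the gauge equations ([flow_of_poles]).  Everything takes
place at a single t, so there are no exceptional points.

Conversely, the flow determines a', b', c', and the normalisation of R by the
eigenvalues theta^oo_i of the residue at infinity makes the strictly lower part
of W equal to that of - N / t ([log_gauge_flow]).  All entries of the three pole
equations are then rational identities ([poles_of_flow]). *)

(** * Derivatives in one variable over a numeric field *)

Section Calculus.
Context {K : numFieldType}.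
Implicit Types (f g : K -> K) (t : K).

Lemma is_derive1E (V : normedModType K) (f : K -> V) t df :
  is_derive t 1 f df -> f^`()%classic t = df.
Proof. by case=> _ <-; rewrite derive1E. Qed.

Lemma is_derive1D f g t df dg : is_derive t 1 f df -> is_derive t 1 g dg ->
  is_derive t 1 (fun s => f s + g s) (df + dg).
Proof. by move=> ? ?; exact: is_deriveD. Qed.

Lemma is_derive1N f t df : is_derive t 1 f df ->
  is_derive t 1 (fun s => - f s) (- df).
Proof. by move=> ?; exact: is_deriveN. Qed.

Lemma is_derive1M f g t df dg : is_derive t 1 f df -> is_derive t 1 g dg ->
  is_derive t 1 (fun s => f s * g s) (df * g t + f t * dg).
Proof.
by move=> ? ?; apply: is_derive_eq; rewrite addrC mulrC.
Qed.

Lemma is_derive1V f t df : f t != 0 -> is_derive t 1 f df ->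
  is_derive t 1 (fun s => (f s)^-1) (- df / f t ^+ 2).
Proof.
move=> f0 fd; have [fv fE] := fd; apply: DeriveDef; first exact: derivableV.
by rewrite deriveV// fE scaleNr mulNr mulrC.
Qed.

Lemma is_derive1_cst (a t : K) : is_derive t 1 (fun=> a) 0.
Proof. exact: is_derive_cst. Qed.

Lemma is_derive1_id (t : K) : is_derive t 1 (fun s => s) 1.
Proof. exact: is_derive_id. Qed.

Lemma is_derive1Zl (V : normedModType K) f (E : V) t df : is_derive t 1 f df ->
  is_derive t 1 (fun s => f s *: E) (df *: E).
Proof.
case=> fv <-.
have fE : h^-1 *: (((fun s => f s *: E) \o shift t) (h *: 1) - f t *: E)
    @[h --> 0^'] --> 'D_1 f t *: E.
  under eq_fun do rewrite /= -scalerBl scalerA.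
  by apply: cvgZr_tmp.
by apply: DeriveDef; [exact: cvgP fE|exact: cvg_lim fE].
Qed.

Lemma is_derive1_sum (V : normedModType K) (I : Type) (r : seq I)
    (F : I -> K -> V) t (dF : I -> V) :
  (forall i, is_derive t 1 (F i) (dF i)) ->
  is_derive t 1 (fun s => \sum_(i <- r) F i s) (\sum_(i <- r) dF i).
Proof.
move=> Fd; elim: r => [|i r IH].
  rewrite big_nil; under eq_fun do rewrite big_nil; exact: is_derive_cst.
rewrite big_cons; under eq_fun do rewrite big_cons; exact: is_deriveD.
Qed.

Lemma derivable1_prod (I : Type) (r : seq I) (F : I -> K -> K) t :
  (forall i, derivable (F i) t 1) -> derivable (fun s => \prod_(i <- r) F i s) t 1.
Proof.
move=> Fd; elim: r => [|i r IH].
  under eq_fun do rewrite big_nil; exact: derivable_cst.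
under eq_fun do rewrite big_cons; exact: derivableM.
Qed.

End Calculus.

(** * Derivatives of matrix-valued functions *)

Section MatrixCalculus.
Context {K : numFieldType}.

(** Entrywise derivability, which is how products and inverses of matrices are
handled; [is_derive_mx] returns to the derivative in the normed space of
matrices. *)
Definition mx_is_derive {m n : nat} (t : K) (M : K -> 'M[K]_(m, n))
    (dM : 'M[K]_(m, n)) :=
  forall i j, is_derive t 1 (fun s => M s i j) (dM i j).

(** Over a field without a total order the matrix norm is inconvenient; expanding
M on the basis of elementary matrices makes it a finite sum of scalar functions
times constant vectors. *)
Lemma is_derive_mx {m n} t (M : K -> 'M[K]_(m, n)) dM :
  mx_is_derive t M dM -> is_derive t 1 M dM.
Proof.
move=> Md.
suff : is_derive t 1 (fun s => \sum_i \sum_j M s i j *: delta_mx i j)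
    (\sum_i \sum_j dM i j *: delta_mx i j).
  by rewrite -matrix_sum_delta; under eq_fun do rewrite -matrix_sum_delta.
by do 2![apply: is_derive1_sum => ?]; exact: is_derive1Zl.
Qed.

Lemma mx_is_deriveD {m n} t (M N : K -> 'M[K]_(m, n)) dM dN :
  mx_is_derive t M dM -> mx_is_derive t N dN ->
  mx_is_derive t (fun s => M s + N s) (dM + dN).
Proof.
by move=> Md Nd i j; under eq_fun do rewrite mxE; rewrite mxE; exact: is_derive1D.
Qed.

Lemma mx_is_deriveZ {m n} t (x : K) (M : K -> 'M[K]_(m, n)) dM :
  mx_is_derive t M dM -> mx_is_derive t (fun s => x *: M s) (x *: dM).
Proof.
move=> Md i j; under eq_fun do rewrite mxE; rewrite mxE.
by have := is_derive1M (is_derive1_cst x t) (Md i j); rewrite mul0r add0r.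
Qed.

Lemma mx_is_deriveM {m n p} t (M : K -> 'M[K]_(m, n)) (N : K -> 'M[K]_(n, p))
    dM dN : mx_is_derive t M dM -> mx_is_derive t N dN ->
  mx_is_derive t (fun s => M s *m N s) (dM *m N t + M t *m dN).
Proof.
move=> Md Nd i j; rewrite !mxE -big_split/=.
under eq_fun do rewrite mxE.
by apply: is_derive1_sum => k; exact: is_derive1M.
Qed.

Lemma derivable_det {n} t (M : K -> 'M[K]_n) :
  (forall i j, derivable (fun s => M s i j) t 1) ->
  derivable (fun s => \det (M s)) t 1.
Proof.
move=> Md; rewrite /determinant.
apply: (@ex_derive _ _ _ _ _ _ (\sum_(s : 'S_n)
  'D_1 (fun x => (-1) ^+ s * \prod_i M x i (s i)) t)).
apply: is_derive1_sum => s; apply/derivableP/derivableM.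
  exact: derivable_cst.
by apply: derivable1_prod => i; exact: Md.
Qed.

(** Near t the determinant stays nonzero, so there the inverse is the adjugate
divided by the determinant, a rational function of the entries.  Invertibility
near t is kept in the conclusion because [invmx] is the identity on
noninvertible matrices. *)
Lemma derivable_invmx {n} t (M : K -> 'M[K]_n) :
  (forall i j, derivable (fun s => M s i j) t 1) -> M t \in unitmx ->
  (forall i j, derivable (fun s => invmx (M s) i j) t 1) /\
  \near t, M t \in unitmx.
Proof.
move=> Md Mt; have detd := derivable_det Md.
have det0 : \det (M t) != 0 by rewrite -unitfE -unitmxE.
have Mnear : \near t, M t \in unitmx.
  have /derivable1_diffP/differentiable_continuous detc := detd.
  near=> s; rewrite unitmxE unitfE.
  by near: s; exact: (cvgr_neq0 (\det (M t))).
split=> // i j.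
have : derivable (fun s => (\det (M s))^-1 * \adj (M s) i j) t 1.
  apply: derivableM; first exact: derivableV.
  under eq_fun do rewrite mxE.
  apply: derivableM; first exact: derivable_cst.
  apply: derivable_det => k l; under eq_fun do rewrite !mxE; exact: Md.
apply: near_eq_derivable; near=> s.
by rewrite /invmx (near Mnear s)// [RHS]mxE.
Unshelve. all: by end_near. Qed.

Lemma mx_is_derive_unique {m n} t (M : K -> 'M[K]_(m, n)) dM dM' :
  mx_is_derive t M dM -> mx_is_derive t M dM' -> dM = dM'.
Proof. by move=> d d'; apply/matrixP=> i j; case: (d i j) (d' i j) => ? <- [? <-]. Qed.

(** A moving frame adds the commutator with its logarithmic derivative W: by
differentiating G^-1 G = 1, one gets (G^-1)' = - G^-1 W. *)
Lemma mx_is_derive_conj {n} t (M G : K -> 'M[K]_n) dM W :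
  mx_is_derive t M dM -> mx_is_derive t G (W *m G t) -> G t \in unitmx ->
  mx_is_derive t (fun s => invmx (G s) *m M s *m G s)
    (invmx (G t) *m (dM + (M t *m W - W *m M t)) *m G t).
Proof.
move=> Md Gd Gt.
have [Hd Gnear] : _ /\ _ := derivable_invmx (fun i j => @ex_derive _ _ _ _ _ _ _ (Gd i j)) Gt.
set dH : 'M[K]_n := \matrix_(i, j) 'D_1 (fun s => invmx (G s) i j) t.
have Hd' : mx_is_derive t (fun s => invmx (G s)) dH.
  by move=> i j; rewrite mxE; exact/derivableP.
have : dH *m G t + invmx (G t) *m (W *m G t) = 0.
  apply: mx_is_derive_unique (mx_is_deriveM Hd' Gd) _ => i j.
  rewrite mxE; apply: (near_eq_is_derive _ (is_derive1_cst ((1%:M : 'M[K]_n) i j) t)).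
  by near=> s; rewrite mulVmx// (near Gnear s).
move/(congr1 (mulmx^~ (invmx (G t)))); rewrite mulmxDl mul0mx !mulmxA !mulmxK//.
move/eqP; rewrite addr_eq0 => /eqP dHE.
suff -> : invmx (G t) *m (dM + (M t *m W - W *m M t)) *m G t =
    (dH *m M t + invmx (G t) *m dM) *m G t
      + invmx (G t) *m M t *m (W *m G t).
  by do !apply: mx_is_deriveM.
rewrite dHE !mulmxDr !mulmxDl !mulNmx !mulmxN !mulNmx !mulmxA.
by rewrite -[RHS]addrA [RHS]addrC -addrA.
Unshelve. all: by end_near. Qed.

End MatrixCalculus.

(** The middle term is the x-derivative of the connection in t, whose hatted form
is a multiple of N.  Both members of the pair are conjugated by the same g, so
the conjugation comes out of their commutator. *)
Lemma conj_curvature (K : fieldType) n (g A N Y : 'M[K]_n) (c e : K) :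
  g \in unitmx ->
  invmx g *m Y *m g - c *: (invmx g *m N *m g)
  + (invmx g *m A *m g *m (e *: (invmx g *m N *m g))
     - e *: (invmx g *m N *m g) *m (invmx g *m A *m g))
  = invmx g *m (Y - c *: N + e *: (A *m N - N *m A)) *m g.
Proof.
move=> gu; rewrite mulmxDr mulmxDl mulmxBr mulmxBl -!scalemxAr -!scalemxAl.
by rewrite mulmxBr mulmxBl !mulmxA !mulmxK// -scalerBr.
Qed.

(** * Explicit 3 x 3 matrices *)

Section ThreeByThree.
Context {K : numFieldType}.

Lemma mx3_ind (P : 'I_3 -> 'I_3 -> Prop) :
  P 0 0 -> P 0 1 -> P 0 2 -> P 1 0 -> P 1 1 -> P 1 2 ->
  P 2 0 -> P 2 1 -> P 2 2 -> forall i j, P i j.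
Proof.
have ordE (k : 'I_3) : [\/ k = 0, k = 1 | k = 2].
  by case: k => [[|[|[|//]]] ?]; [apply: Or31|apply: Or32|apply: Or33];
    apply/val_inj.
by move=> ? ? ? ? ? ? ? ? ? i j; case: (ordE i) => ->; case: (ordE j) => ->.
Qed.

(** A form in which the nine entries are separate variables, so that sums and
products compute to the same form. *)
Definition of_rows (a b c d e f g h k : K) : 'M[K]_3 :=
  mx3 [:: [:: a; b; c]; [:: d; e; f]; [:: g; h; k]].

Lemma of_rows_eq0 a b c d e f g h k : of_rows a b c d e f g h k = 0 <->
  [/\ a = 0, b = 0 & c = 0] /\ [/\ d = 0, e = 0 & f = 0] /\
  [/\ g = 0, h = 0 & k = 0].
Proof.
split=> [/matrixP M0|[[-> -> ->] [[-> -> ->] [-> -> ->]]]].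
  have := (M0 0 0, M0 0 1, M0 0 2, M0 1 0, M0 1 1, M0 1 2, M0 2 0, M0 2 1, M0 2 2).
  by rewrite !mxE/=; do !case.
by apply/matrixP; apply: mx3_ind; rewrite !mxE.
Qed.

Lemma of_rowsD a b c d e f g h k a' b' c' d' e' f' g' h' k' :
  of_rows a b c d e f g h k + of_rows a' b' c' d' e' f' g' h' k' =
  of_rows (a + a') (b + b') (c + c') (d + d') (e + e') (f + f')
          (g + g') (h + h') (k + k').
Proof. by apply/matrixP; apply: mx3_ind; rewrite !mxE. Qed.

Lemma of_rowsN a b c d e f g h k :
  - of_rows a b c d e f g h k =
  of_rows (- a) (- b) (- c) (- d) (- e) (- f) (- g) (- h) (- k).
Proof. by apply/matrixP; apply: mx3_ind; rewrite !mxE. Qed.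

Lemma of_rowsZ z a b c d e f g h k :
  z *: of_rows a b c d e f g h k =
  of_rows (z * a) (z * b) (z * c) (z * d) (z * e) (z * f)
          (z * g) (z * h) (z * k).
Proof. by apply/matrixP; apply: mx3_ind; rewrite !mxE. Qed.

Lemma of_rowsM a b c d e f g h k a' b' c' d' e' f' g' h' k' :
  of_rows a b c d e f g h k *m of_rows a' b' c' d' e' f' g' h' k' =
  of_rows (a * a' + b * d' + c * g') (a * b' + b * e' + c * h')
          (a * c' + b * f' + c * k')
          (d * a' + e * d' + f * g') (d * b' + e * e' + f * h')
          (d * c' + e * f' + f * k')
          (g * a' + h * d' + k * g') (g * b' + h * e' + k * h')
          (g * c' + h * f' + k * k').
Proof.
by apply/matrixP; apply: mx3_ind;
  rewrite !mxE !big_ord_recr big_ord0/= add0r !mxE.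
Qed.

Definition of_rowsE := (of_rowsM, of_rowsZ, of_rowsN, of_rowsD).

Lemma mx_is_derive_of_rows (t : K) (a b c d e f g h k : K -> K)
    (a' b' c' d' e' f' g' h' k' : K) :
  is_derive t 1 a a' -> is_derive t 1 b b' -> is_derive t 1 c c' ->
  is_derive t 1 d d' -> is_derive t 1 e e' -> is_derive t 1 f f' ->
  is_derive t 1 g g' -> is_derive t 1 h h' -> is_derive t 1 k k' ->
  mx_is_derive t (fun s => of_rows (a s) (b s) (c s) (d s) (e s) (f s)
                                   (g s) (h s) (k s))
    (of_rows a' b' c' d' e' f' g' h' k').
Proof.
by move=> *; apply: mx3_ind; rewrite mxE/=; under eq_fun do rewrite mxE.
Qed.

Lemma unitmx_lower a d e g h k : a != 0 -> e != 0 -> k != 0 ->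
  of_rows a 0 0 d e 0 g h k \in unitmx.
Proof.
move=> a0 e0 k0; rewrite unitmxE det_trig; last first.
  by apply/is_trig_mxP; apply: mx3_ind; rewrite // mxE.
have diag_neq0 : forall i j, i = j -> of_rows a 0 0 d e 0 g h k i j != 0.
  by apply: mx3_ind; rewrite // mxE.
by rewrite unitfE; apply/prodf_neq0 => i _; exact: diag_neq0.
Qed.

End ThreeByThree.

Section LaxMatrixRows.
Context {K : numFieldType} (th : exponents K) (t q1 p1 q2 p2 u v : K).

Lemma hatA1_m1E : hatA1_m1 t p1 p2 = of_rows
  (p1 + p2 + t) (- t) (- t)
  (p2 / t * (p1 + p2 + t)) (p2 / t * - t) (p2 / t * - t)
  (p1 / t * (p1 + p2 + t)) (p1 / t * - t) (p1 / t * - t).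
Proof.
by apply/matrixP; apply: mx3_ind;
  rewrite !mxE big_ord_recr big_ord0/= add0r !mxE/= ?mul1r.
Qed.

Lemma gaugeGE : gaugeG th t q1 p1 q2 p2 u v = of_rows
  1 0 0
  (coef_a th t p1 q2 p2 / (thoo_1 th - thoo_2 th)) u 0
  ((coef_b th t q1 p1 p2 + coef_a th t p1 q2 p2 * coef_c th q1 p1 q2
       / (thoo_1 th - thoo_2 th)) / (thoo_1 th - thoo_3 th))
  (coef_c th q1 p1 q2 / (thoo_2 th - thoo_3 th) * u) v.
Proof.
by apply/matrixP; apply: mx3_ind;
  rewrite /gaugeG mul_mx_diag !mxE/= ?mulr1 ?mul0r ?mul1r.
Qed.

End LaxMatrixRows.

(** * The pole equations and the flow *)

Section PoleConditions.
Context {K : numFieldType} (th : exponents K).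
(* The velocities dq1, dp1, dq2, dp2 and the logarithmic derivatives U, V of u, v
   are independent scalars here, so that the section is pure algebra at one t. *)
Variables (t q1 p1 q2 p2 dq1 dp1 dq2 dp2 U V : K).

Local Notation th02 := (th0_2 th).
Local Notation th11 := (th1 th).
Local Notation thi1 := (thoo_1 th).
Local Notation thi2 := (thoo_2 th).
Local Notation thi3 := (thoo_3 th).
Local Notation d12 := (thi1 - thi2).
Local Notation d13 := (thi1 - thi3).
Local Notation d23 := (thi2 - thi3).
Local Notation a := (coef_a th t p1 q2 p2).
Local Notation b := (coef_b th t q1 p1 p2).
Local Notation c := (coef_c th q1 p1 q2).
Local Notation N := (hatA1_m1 t p1 p2).
Local Notation A1 := (hatA1_0 th t q1 p1 q2 p2).
Local Notation A0 := (hatA0_0 th t q1 q2 p2).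

(** From the Leibniz rule for t a: the derivative of the numerator of [coef_a] is
a + t a'. *)
Definition dcoef_a : K :=
  (dp2 * (q2 - 1) * (p1 + p2 + t) + p2 * dq2 * (p1 + p2 + t)
   + p2 * (q2 - 1) * (dp1 + dp2 + 1) - (th02 + thi2) * (dp1 + 1)
   - (2 * th02 + th11 + 2 * thi2 + thi3) * dp2 - a) / t.

Definition dcoef_b : K :=
  (dp1 * (q1 - 1) * (p1 + p2 + t) + p1 * dq1 * (p1 + p2 + t)
   + p1 * (q1 - 1) * (dp1 + dp2 + 1) - thi3 * (dp2 + 1)
   - (th02 + th11 + thi2 + 2 * thi3) * dp1 - b) / t.

Definition dcoef_c : K := dp1 * (q2 - q1) + p1 * (dq2 - dq1).

Definition dhatA0_0 : 'M[K]_3 := of_rows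
  0 (q2 - 1 + t * dq2) (q1 - 1 + t * dq1)
  0 0 (dp2 * (q1 - q2) + p2 * (dq1 - dq2))
  0 0 0.

Definition dhatA1_m1 : 'M[K]_3 :=
  let r2 := (dp2 - p2 / t) / t in let r1 := (dp1 - p1 / t) / t in
  of_rows
  (dp1 + dp2 + 1) (- 1) (- 1)
  (r2 * (p1 + p2 + t) + p2 / t * (dp1 + dp2 + 1)) (- dp2) (- dp2)
  (r1 * (p1 + p2 + t) + p1 / t * (dp1 + dp2 + 1)) (- dp1) (- dp1).

Definition dhatA1_0 : 'M[K]_3 := of_rows
  0 (1 - q2 - t * dq2) (1 - q1 - t * dq1)
  (- dcoef_a) 0 (dp2 * (q2 - q1) + p2 * (dq2 - dq1))
  (- dcoef_b) (dp1 * (q1 - q2) + p1 * (dq1 - dq2)) 0.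

Definition log_lower (w21 w31 w32 : K) : 'M[K]_3 :=
  of_rows 0 0 0 w21 U 0 w31 w32 V.

(** The matrix G' G^-1, found by solving W G = G' in each row from the diagonal
leftwards; u and v enter only through U = u'/u and V = v'/v. *)
Definition log_gauge : 'M[K]_3 :=
  let w32 := dcoef_c / d23 - (V - U) * (c / d23) in
  log_lower
    (dcoef_a / d12 - U * (a / d12))
    ((dcoef_b + (dcoef_a * c + a * dcoef_c) / d12) / d13
      - w32 * (a / d12) - V * ((b + a * c / d12) / d13))
    w32.

(** The coefficients of (x - 1)^-2, (x - 1)^-1 and x^-1 in the curvature.  The
commutators with N in [pole1] and [pole0] both come from the product of 1/x and
1/(x - 1), whence their opposite signs. *)
Definition pole2 (W : 'M[K]_3) : 'M[K]_3 :=
  dhatA1_m1 + (N *m W - W *m N) - t^-1 *: N - t^-1 *: (A1 *m N - N *m A1).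

Definition pole1 (W : 'M[K]_3) : 'M[K]_3 :=
  dhatA1_0 + (A1 *m W - W *m A1) - t^-1 *: (A0 *m N - N *m A0).

Definition pole0 (W : 'M[K]_3) : 'M[K]_3 :=
  dhatA0_0 + (A0 *m W - W *m A0) + t^-1 *: (A0 *m N - N *m A0).

(** Hamilton's equations, multiplied by t. *)
Definition NY_flow : Prop :=
  [/\ t * dq1 = (2 * p1 + t) * q1 * (q1 - 1) + (kappa th - 1) * q1
                - thi1 + thi3 + 1 + 2 * p2 * q1 * (q2 - 1),
      t * dp1 = thi3 * t - p1 * (p1 + t) * (2 * q1 - 1)
                - (kappa th - 1) * p1 - 2 * p1 * p2 * (q2 - 1),
      t * dq2 = (2 * p2 + t) * q2 * (q2 - 1) + (kappa th - 1) * q2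
                - thi1 + thi2 + thi3 + 1 + 2 * p1 * q1 * (q2 - 1) &
      t * dp2 = (th02 + thi2) * t - p2 * (p2 + t) * (2 * q2 - 1)
                - (kappa th - 1) * p2 - 2 * p1 * p2 * q1].

Definition gauge_flow : Prop :=
  t * U = p1 * (1 - 2 * q1) + (2 * p2 + t) * (1 - q2) - kappa th /\
  t * V = (2 * p1 + t) * (1 - q1) + 2 * p2 * (1 - q2) - kappa th.

Hypotheses (th_sum : fuchs th) (t0 : t != 0).

Lemma th0_1_fuchs : th0_1 th = - (th02 + th11 + thi1 + thi2 + thi3).
Proof.
by apply/eqP; rewrite -subr_eq0 opprK -(eqP (introT eqP th_sum)); apply/eqP; ring.
Qed.

(** With Z = W + N / t, the strictly lower part of the equation reads, from the
bottom-left corner on, (0 - theta^0_1) Z_31 = 0,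
then (0 - theta^0_2) Z_32 = 0 and (theta^0_2 - theta^0_1) Z_21 = 0. *)
Lemma residue_log_lower w21 w31 w32 :
  uniq [:: 0; th0_1 th; th02] -> pole0 (log_lower w21 w31 w32) = 0 ->
  [/\ w21 = - (p2 * (p1 + p2 + t) / t ^+ 2),
      w31 = - (p1 * (p1 + p2 + t) / t ^+ 2) & w32 = p1 / t].
Proof.
rewrite /= !inE !negb_or andbT => /andP[/andP[n01 n02] n12].
rewrite /pole0 /log_lower hatA1_m1E /hatA0_0 /dhatA0_0 -/(of_rows _ _ _ _ _ _ _ _ _).
rewrite !of_rowsE => /of_rows_eq0[_ [[e21 _ _] [e31 e32 _]]].
have E31 : w31 = - (p1 * (p1 + p2 + t) / t ^+ 2).
  apply/eqP; rewrite -subr_eq0; have: th0_1 th != 0 by rewrite eq_sym.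
  move=> /mulIf/inj_eq <-; rewrite mul0r -oppr_eq0 -e31; apply/eqP; by field.
have E32 : w32 = p1 / t.
  apply/eqP; rewrite -subr_eq0; have: th02 != 0 by rewrite eq_sym.
  move=> /mulIf/inj_eq <-; rewrite mul0r -oppr_eq0 -e32 E31; apply/eqP; by field.
have E21 : w21 = - (p2 * (p1 + p2 + t) / t ^+ 2).
  apply/eqP; rewrite -subr_eq0; have: th0_1 th - th02 != 0 by rewrite subr_eq0.
  move=> /mulIf/inj_eq <-; rewrite mul0r -oppr_eq0 -e21 E31; apply/eqP; by field.
by [].
Qed.

(** Entries (1,2), (1,3) of [pole2] have - t U and - t V as only unknown terms, its
entries (2,2), (3,3) have - dp2 and - dp1, and entries (1,2), (1,3) of [pole0]
have t dq2 and t dq1 once U and V are replaced by their values. *)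
Lemma flow_of_poles w21 w31 w32 :
  uniq [:: 0; th0_1 th; th02] ->
  pole2 (log_lower w21 w31 w32) = 0 -> pole0 (log_lower w21 w31 w32) = 0 ->
  NY_flow /\ gauge_flow.
Proof.
move=> th0_distinct P2 P0.
have [E21 E31 E32] := residue_log_lower th0_distinct P0.
move: P2 P0; rewrite /pole2 /pole0 /log_lower hatA1_m1E /hatA0_0 /hatA1_0.
rewrite /dhatA0_0 /dhatA1_m1 -/(of_rows _ _ _ _ _ _ _ _ _).
rewrite -/(of_rows (th02 + th11 + thi2 + thi3) _ _ _ _ _ _ _ _).
rewrite E21 E31 E32 !of_rowsE.
move=> /of_rows_eq0[[_ e12 e13] [[_ e22 _] [_ _ e33]]].
move=> /of_rows_eq0[[_ f12 f13] _].
have EU : t * U = p1 * (1 - 2 * q1) + (2 * p2 + t) * (1 - q2) - kappa th.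
  apply/eqP; rewrite -subr_eq0 -oppr_eq0 -e12 /kappa th0_1_fuchs; apply/eqP; by field.
have EV : t * V = (2 * p1 + t) * (1 - q1) + 2 * p2 * (1 - q2) - kappa th.
  apply/eqP; rewrite -subr_eq0 -oppr_eq0 -e13 /kappa th0_1_fuchs; apply/eqP; by field.
have U_E : U = (p1 * (1 - 2 * q1) + (2 * p2 + t) * (1 - q2) - kappa th) / t.
  by rewrite -EU mulrC mulKf.
have V_E : V = ((2 * p1 + t) * (1 - q1) + 2 * p2 * (1 - q2) - kappa th) / t.
  by rewrite -EV mulrC mulKf.
split=> //; split.
- apply/eqP; rewrite -subr_eq0 -f13 V_E /kappa th0_1_fuchs; apply/eqP; by field.
- apply/eqP; rewrite -subr_eq0 -oppr_eq0 -(mulr0 t) -e33 /coef_b /kappa th0_1_fuchs.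
  by apply/eqP; field.
- apply/eqP; rewrite -subr_eq0 -f12 U_E /kappa th0_1_fuchs; apply/eqP; by field.
- apply/eqP; rewrite -subr_eq0 -oppr_eq0 -(mulr0 t) -e22 /coef_a /kappa th0_1_fuchs.
  by apply/eqP; field.
Qed.

(** R diagonalizes hatA0 + hatA1, whose eigenvalues - theta^oo_i are constant; hence
the equation W = G' G^-1 for the lower entries is the isospectral evolution of
a, b, c driven by - N / t, and this is what the flow yields. *)
Lemma log_gauge_flow : uniq [:: thi1; thi2; thi3] -> NY_flow -> gauge_flow ->
  log_gauge = log_lower (- (p2 * (p1 + p2 + t) / t ^+ 2))
    (- (p1 * (p1 + p2 + t) / t ^+ 2)) (p1 / t).
Proof.
rewrite /= !inE !negb_or andbT => /andP[/andP[n12 n13] n23].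
have d12_0 : d12 != 0 by rewrite subr_eq0.
have d13_0 : d13 != 0 by rewrite subr_eq0.
have d23_0 : d23 != 0 by rewrite subr_eq0.
rewrite /NY_flow /gauge_flow /kappa th0_1_fuchs => -[Eq1 Ep1 Eq2 Ep2] [EU EV].
have divt x y : t * x = y -> x = y / t by move=> <-; rewrite mulrC mulKf.
move: Eq1 Ep1 Eq2 Ep2 EU EV => /divt Eq1 /divt Ep1 /divt Eq2 /divt Ep2 /divt EU /divt EV.
rewrite /log_gauge /log_lower; congr of_rows.
- rewrite /dcoef_a /coef_a Ep1 Ep2 Eq2 EU; field. by rewrite t0.
- rewrite /dcoef_a /dcoef_b /dcoef_c /coef_a /coef_b /coef_c Ep1 Ep2 Eq1 Eq2 EU EV; field.
  by rewrite t0 d12_0 d13_0.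
- rewrite /dcoef_c /coef_c Ep1 Eq1 Eq2 EU EV; field. by rewrite t0.
Qed.

(** After [log_gauge_flow] the differences of the theta^oo_i have disappeared and t
is the only denominator. *)
Lemma poles_of_flow : uniq [:: thi1; thi2; thi3] -> NY_flow -> gauge_flow ->
  [/\ pole2 log_gauge = 0, pole1 log_gauge = 0 & pole0 log_gauge = 0].
Proof.
move=> thoo_distinct NY gauge; rewrite log_gauge_flow//.
move: NY gauge; rewrite /NY_flow /gauge_flow /kappa th0_1_fuchs => -[Eq1 Ep1 Eq2 Ep2] [EU EV].
have divt x y : t * x = y -> x = y / t by move=> <-; rewrite mulrC mulKf.
move: Eq1 Ep1 Eq2 Ep2 EU EV => /divt Eq1 /divt Ep1 /divt Eq2 /divt Ep2 /divt EU /divt EV.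
rewrite /pole2 /pole1 /pole0 /log_lower hatA1_m1E /hatA0_0 /hatA1_0.
rewrite /dhatA0_0 /dhatA1_m1 /dhatA1_0 -/(of_rows _ _ _ _ _ _ _ _ _).
rewrite -/(of_rows (th02 + th11 + thi2 + thi3) _ _ _ _ _ _ _ _).
rewrite !of_rowsE; split; apply/of_rows_eq0; (split; [|split]); split;
  rewrite /dcoef_a /dcoef_b /coef_a /coef_b ?th0_1_fuchs ?Ep1 ?Ep2 ?Eq1 ?Eq2 ?EU ?EV;
  by field.
Qed.

End PoleConditions.

(** * The curvature of the Lax pair *)

(** Differentiates an expression in t built from functions with known derivatives
by structural recursion, leaving the derivative as an existential variable. *)
Ltac deriv := first
  [ eassumption | eapply is_derive1_cst | eapply is_derive1_id
  | eapply is_derive1D; deriv | eapply is_derive1N; deriv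
  | eapply is_derive1V; [by [] | deriv] | eapply is_derive1M; deriv ].

Section Isomonodromy.
Context {K : numFieldType} (th : exponents K).
Variables (q1 p1 q2 p2 u v : K -> K) (t dq1 dp1 dq2 dp2 du dv : K).
Hypotheses (t0 : t != 0) (u0 : u t != 0) (v0 : v t != 0).
Hypotheses (thoo_distinct : uniq [:: thoo_1 th; thoo_2 th; thoo_3 th]).
Hypotheses (q1d : is_derive t 1 q1 dq1) (p1d : is_derive t 1 p1 dp1).
Hypotheses (q2d : is_derive t 1 q2 dq2) (p2d : is_derive t 1 p2 dp2).
Hypotheses (ud : is_derive t 1 u du) (vd : is_derive t 1 v dv).

Local Notation N s := (hatA1_m1 s (p1 s) (p2 s)).
Local Notation A1 s := (hatA1_0 th s (q1 s) (p1 s) (q2 s) (p2 s)).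
Local Notation A0 s := (hatA0_0 th s (q1 s) (q2 s) (p2 s)).
Local Notation G s :=
  (gaugeG th s (q1 s) (p1 s) (q2 s) (p2 s) (u s) (v s)).
Local Notation dN := (dhatA1_m1 t (p1 t) (p2 t) dp1 dp2).
Local Notation dA1 :=
  (dhatA1_0 th t (q1 t) (p1 t) (q2 t) (p2 t) dq1 dp1 dq2 dp2).
Local Notation dA0 := (dhatA0_0 t (q1 t) (q2 t) (p2 t) dq1 dq2 dp2).
Local Notation W := (log_gauge th t (q1 t) (p1 t) (q2 t) (p2 t)
  dq1 dp1 dq2 dp2 (du / u t) (dv / v t)).

Lemma is_derive_coef_a : is_derive t 1 (fun s => coef_a th s (p1 s) (q2 s) (p2 s))
  (dcoef_a th t (p1 t) (q2 t) (p2 t) dp1 dq2 dp2).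
Proof.
rewrite /coef_a; eapply is_derive_eq; first by deriv.
by rewrite /dcoef_a /coef_a /=; field.
Qed.

Lemma is_derive_coef_b : is_derive t 1 (fun s => coef_b th s (q1 s) (p1 s) (p2 s))
  (dcoef_b th t (q1 t) (p1 t) (p2 t) dq1 dp1 dp2).
Proof.
rewrite /coef_b; eapply is_derive_eq; first by deriv.
by rewrite /dcoef_b /coef_b /=; field.
Qed.

Lemma is_derive_coef_c : is_derive t 1 (fun s => coef_c th (q1 s) (p1 s) (q2 s))
  (dcoef_c (q1 t) (p1 t) (q2 t) dq1 dp1 dq2).
Proof.
rewrite /coef_c; eapply is_derive_eq; first by deriv.
by rewrite /dcoef_c /=; ring.
Qed.

Lemma is_derive_hatA0_0 : mx_is_derive t (fun s => A0 s) dA0.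
Proof.
apply: mx_is_derive_of_rows; (eapply is_derive_eq; [by deriv|rewrite /=; by ring]).
Qed.

Lemma is_derive_hatA1_m1 : mx_is_derive t (fun s => N s) dN.
Proof.
under eq_fun do rewrite hatA1_m1E.
apply: mx_is_derive_of_rows; (eapply is_derive_eq; [by deriv|rewrite /=; by field]).
Qed.

Lemma is_derive_hatA1_0 : mx_is_derive t (fun s => A1 s) dA1.
Proof.
have := (is_derive_coef_a, is_derive_coef_b) => -[ad bd].
apply: mx_is_derive_of_rows; (eapply is_derive_eq; [by deriv|rewrite /=; by ring]).
Qed.

(** Checks that [log_gauge] is G' G^-1, in the inverse-free form G' = W G. *)
Lemma is_derive_gaugeG : mx_is_derive t (fun s => G s) (W *m G t).
Proof.
have := thoo_distinct.
rewrite /= !inE !negb_or andbT => /andP[/andP[n12 n13] n23].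
have d12_0 : thoo_1 th - thoo_2 th != 0 by rewrite subr_eq0.
have d13_0 : thoo_1 th - thoo_3 th != 0 by rewrite subr_eq0.
have d23_0 : thoo_2 th - thoo_3 th != 0 by rewrite subr_eq0.
have ad := is_derive_coef_a; have bd := is_derive_coef_b.
have cd := is_derive_coef_c.
under eq_fun do rewrite gaugeGE.
rewrite gaugeGE /log_gauge /log_lower of_rowsM.
apply: mx_is_derive_of_rows; (eapply is_derive_eq; [by deriv|]);
  rewrite /=; field; by rewrite ?u0 ?v0 ?d12_0 ?d13_0 ?d23_0.
Qed.

Lemma gaugeG_unit : G t \in unitmx.
Proof. by rewrite gaugeGE unitmx_lower// oner_eq0. Qed.

Lemma is_derive_laxA x : mx_is_derive t (fun s => laxA th q1 p1 q2 p2 u v s x)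
  (let Ahat := ((x - 1) ^+ 2)^-1 *: N t + (x - 1)^-1 *: A1 t + x^-1 *: A0 t in
   invmx (G t) *m
   (((x - 1) ^+ 2)^-1 *: dN + (x - 1)^-1 *: dA1 + x^-1 *: dA0
     + (Ahat *m W - W *m Ahat)) *m G t).
Proof.
rewrite /laxA; apply: (mx_is_derive_conj (G := fun s => G s)); last exact: gaugeG_unit.
  apply: mx_is_deriveD; first apply: mx_is_deriveD; apply: mx_is_deriveZ.
  - exact: is_derive_hatA1_m1.
  - exact: is_derive_hatA1_0.
  - exact: is_derive_hatA0_0.
exact: is_derive_gaugeG.
Qed.

Lemma derive1_laxB x : x != 1 -> (fun y => laxB th q1 p1 q2 p2 u v t y)^`()%classic x
  = (t * (x - 1) ^+ 2)^-1 *: (invmx (G t) *m N t *m G t).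
Proof.
move=> x1; have x10 : x - 1 != 0 by rewrite subr_eq0.
have tx0 : t * (x - 1) != 0 by rewrite mulf_neq0.
apply: is_derive1E; apply: is_derive1Zl; eapply is_derive_eq; first by deriv.
by rewrite /=; field; rewrite t0 x10.
Qed.

(** The term (x - 1)^-2 N of hatA commutes with hatB, so no pole of order three
appears; the rest is the splitting 1 / (x (x - 1)) = 1 / (x - 1) - 1 / x. *)
Lemma zero_curvature_poles x : x != 0 -> x != 1 ->
  zero_curvature th q1 p1 q2 p2 u v t x <->
  ((x - 1) ^+ 2)^-1
    *: pole2 th t (q1 t) (p1 t) (q2 t) (p2 t) dp1 dp2 W
  + (x - 1)^-1
    *: pole1 th t (q1 t) (p1 t) (q2 t) (p2 t) dq1 dp1 dq2 dp2 W
  + x^-1 *: pole0 th t (q1 t) (p1 t) (q2 t) (p2 t) dq1 dq2 dp2 W = 0.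
Proof.
move=> x0 x1; have x10 : x - 1 != 0 by rewrite subr_eq0.
rewrite /zero_curvature derive1_laxB// (is_derive1E (is_derive_mx (is_derive_laxA x))).
rewrite /laxA /laxB /pole2 /pole1 /pole0 /=.
have Gu := gaugeG_unit.
move: (G t) Gu (N t) (A1 t) (A0 t) dN dA1 dA0 W => g gu n a1 a0 dn da1 da0 w.
rewrite conj_curvature//.
set A := ((x - 1) ^+ 2)^-1 *: n + (x - 1)^-1 *: a1 + x^-1 *: a0.
set P := (X in _ <-> X = 0).
have -> : ((x - 1) ^+ 2)^-1 *: dn + (x - 1)^-1 *: da1 + x^-1 *: da0
    + (A *m w - w *m A) - (t * (x - 1) ^+ 2)^-1 *: n
    + - (t * (x - 1))^-1 *: (A *m n - n *m A) = P.
  rewrite /P /A !mulmxDl !mulmxDr -!scalemxAl -!scalemxAr.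
  move: (n *m w) (w *m n) (a1 *m w) (w *m a1) (a0 *m w) (w *m a0).
  move: (a1 *m n) (n *m a1) (a0 *m n) (n *m a0) (n *m n) => *.
  by apply/matrixP => i j; rewrite !mxE; field; rewrite t0 x0 x10.
split=> [/(congr1 (fun M => g *m M *m invmx g))|->]; last by rewrite mulmx0 mul0mx.
by rewrite mulmx0 mul0mx !mulmxA mulmxV// mul1mx mulmxK.
Qed.

End Isomonodromy.

(** * Partial fractions in the spectral parameter *)

Section PartialFractions.
Context {K : numFieldType}.

(** The three functions are linearly independent already on the points 2, - 1 and
1 / 2, where the system for the coefficients has a nonzero determinant. *)
Lemma partial_fractions_eq0 m n (P2 P1 P0 : 'M[K]_(m, n)) :
  (forall x : K, x != 0 -> x != 1 ->
     ((x - 1) ^+ 2)^-1 *: P2 + (x - 1)^-1 *: P1 + x^-1 *: P0 = 0) <->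
  [/\ P2 = 0, P1 = 0 & P0 = 0].
Proof.
split=> [PE|[-> -> ->] x _ _]; last by rewrite !scaler0 !addr0.
have two0 : (2 : K) != 0 by rewrite pnatr_eq0.
suff entries i j : [/\ P2 i j = 0, P1 i j = 0 & P0 i j = 0].
  by split; apply/matrixP => i j; have [] := entries i j; rewrite !mxE.
have at_ (x : K) : x != 0 -> x != 1 ->
    ((x - 1) ^+ 2)^-1 * P2 i j + (x - 1)^-1 * P1 i j + x^-1 * P0 i j = 0.
  by move=> x0 x1; have /matrixP/(_ i j) := PE x x0 x1; rewrite !mxE.
have natE (m' n' : nat) : m' != n' -> m'%:R != n'%:R :> K by rewrite eqr_nat.
have e1 : P2 i j + P1 i j + P0 i j / 2 = 0.
  by rewrite -(at_ 2 two0 (natE 2 1 isT)); field.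
have e2 : P2 i j / 4 - P1 i j / 2 - P0 i j = 0.
  rewrite -(at_ (- 1)) ?oppr_eq0 ?oner_eq0//.
    by field.
  by rewrite eq_sym -addr_eq0; exact: natE 2 0 isT.
have e3 : 4 * P2 i j - 2 * P1 i j + 2 * P0 i j = 0.
  rewrite -(at_ 2^-1) ?invr_eq0//; first by field.
  by rewrite -(inj_eq (mulfI two0)) mulfV// mulr1 eq_sym (natE 2 1).
(* The combinations below are the rows of the inverse of that 3 x 3 system. *)
move: (P2 i j) (P1 i j) (P0 i j) e1 e2 e3 {at_} => a b c e1 e2 e3.
split.
- have -> : a = 4 / 9 * ((a / 4 - b / 2 - c) + (a + b + c / 2)
      + (4 * a - 2 * b + 2 * c) / 4) by field.
  by rewrite e1 e2 e3 !(mul0r, addr0, mulr0).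
- have -> : b = 2 / 3 * (a + b + c / 2) - (4 * a - 2 * b + 2 * c) / 6 by field.
  by rewrite e1 e3 mul0r mulr0 subr0.
- have -> : c = - (2 / 9) * (a + b + c / 2) - 8 / 9 * (a / 4 - b / 2 - c)
      + (4 * a - 2 * b + 2 * c) / 9 by field.
  by rewrite e1 e2 e3 !(mul0r, addr0, mulr0, subr0).
Qed.

End PartialFractions.

(** * Hamilton's equations and the main equivalence *)

Section HamiltonianFlow.
Context {K : numFieldType} (th : exponents K).

Lemma hamiltonian_flow (q1 p1 q2 p2 : K -> K) t : t != 0 ->
  hamiltonian_system (NY_H th) q1 p1 q2 p2 t <->
  NY_flow th t (q1 t) (p1 t) (q2 t) (p2 t) (q1^`()%classic t) (p1^`()%classic t)
    (q2^`()%classic t) (p2^`()%classic t).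
Proof.
move=> t0; rewrite /hamiltonian_system /NY_flow.
have scale (x y z : K) : z = t * y -> (x = y <-> t * x = z).
  move=> ->; split=> [->//|]; exact: mulfI.
have and4_iff (P1 P2 P3 P4 Q1 Q2 Q3 Q4 : Prop) : (P1 <-> Q1) -> (P2 <-> Q2) ->
    (P3 <-> Q3) -> (P4 <-> Q4) -> [/\ P1, P2, P3 & P4] <-> [/\ Q1, Q2, Q3 & Q4].
  by move=> [? ?] [? ?] [? ?] [? ?]; split=> -[]; split; auto.
apply: and4_iff; apply: scale; rewrite /NY_H /NY_tH /tH_V.
- erewrite is_derive1E; [|by deriv]. rewrite /=; by field.
- erewrite is_derive1E; [|by deriv]. rewrite /=; by field.
- erewrite is_derive1E; [|by deriv]. rewrite /=; by field.
- erewrite is_derive1E; [|by deriv]. rewrite /=; by field.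
Qed.

End HamiltonianFlow.

(** The equivalence holds at each t separately: the pole equations involve only the
values and the first derivatives of the six functions at t. *)
Lemma zero_curvature_flow (K : numFieldType) (th : exponents K)
    (q1 p1 q2 p2 u v : K -> K) (t : K) :
  fuchs th -> uniq [:: 0; th0_1 th; th0_2 th] ->
  uniq [:: thoo_1 th; thoo_2 th; thoo_3 th] -> t != 0 ->
  u t != 0 -> v t != 0 ->
  derivable q1 t 1 -> derivable p1 t 1 -> derivable q2 t 1 ->
  derivable p2 t 1 -> derivable u t 1 -> derivable v t 1 ->
  (forall x, x != 0 -> x != 1 -> zero_curvature th q1 p1 q2 p2 u v t x) <->
  hamiltonian_system (NY_H th) q1 p1 q2 p2 t /\
  gauge_equations th q1 p1 q2 p2 u v t.
Proof.
move=> th_sum th0_distinct thoo_distinct t0 u0 v0.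
do 6![move=> /derivableP; rewrite -derive1E => ?].
have gaugeE : gauge_equations th q1 p1 q2 p2 u v t <->
    gauge_flow th t (q1 t) (p1 t) (q2 t) (p2 t)
      (u^`()%classic t / u t) (v^`()%classic t / v t).
  by rewrite /gauge_equations /gauge_flow 2![t / _ * _]mulrAC -2!mulrA.
rewrite hamiltonian_flow// gaugeE.
set W := log_gauge th t (q1 t) (p1 t) (q2 t) (p2 t)
  (q1^`()%classic t) (p1^`()%classic t) (q2^`()%classic t) (p2^`()%classic t)
  (u^`()%classic t / u t) (v^`()%classic t / v t).
have -> : (forall x, x != 0 -> x != 1 -> zero_curvature th q1 p1 q2 p2 u v t x) <->
   [/\ pole2 th t (q1 t) (p1 t) (q2 t) (p2 t)
         (p1^`()%classic t) (p2^`()%classic t) W = 0,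
       pole1 th t (q1 t) (p1 t) (q2 t) (p2 t) (q1^`()%classic t)
         (p1^`()%classic t) (q2^`()%classic t) (p2^`()%classic t) W = 0 &
       pole0 th t (q1 t) (p1 t) (q2 t) (p2 t) (q1^`()%classic t)
         (q2^`()%classic t) (p2^`()%classic t) W = 0].
  rewrite -partial_fractions_eq0; split=> H x x0 x1; have := H x x0 x1;
    by rewrite -(zero_curvature_poles (du := u^`()%classic t) (dv := v^`()%classic t)).
split=> [[P2 _ P0]|[NY gauge]]; last exact: poles_of_flow.
exact: flow_of_poles P2 P0.
Qed.

Unset Implicit Arguments.

Theorem mainTheorem8 (R : realType) (th : exponents (Cplx R))
    (D : set (Cplx R)) (q1 p1 q2 p2 u v : Cplx R -> Cplx R)
    (th_sum : fuchs th)
    (th0_distinct : uniq [:: 0; th0_1 th; th0_2 th])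
    (thoo_distinct : uniq [:: thoo_1 th; thoo_2 th; thoo_3 th])
    (D_domain : domain D) (D_neq0 : forall t, D t -> t != 0)
    (q1_holo : holomorphic_on D q1) (p1_holo : holomorphic_on D p1)
    (q2_holo : holomorphic_on D q2) (p2_holo : holomorphic_on D p2)
    (u_holo : holomorphic_on D u) (v_holo : holomorphic_on D v)
    (u_neq0 : forall t, D t -> u t != 0)
    (v_neq0 : forall t, D t -> v t != 0) :
  (forall t, D t -> forall x, x != 0 -> x != 1 ->
     zero_curvature th q1 p1 q2 p2 u v t x)
  <->
  (forall t, D t ->
     hamiltonian_system (NY_H th) q1 p1 q2 p2 t /\
     gauge_equations th q1 p1 q2 p2 u v t).
Proof.
split=> [zc t Dt|flow t Dt].
  by apply/zero_curvature_flow; auto using (zc t Dt).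
by have := flow t Dt; rewrite -zero_curvature_flow; auto.
Qed.
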